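(* Let $\epsilon_1,\epsilon_2,\dots$ be i.i.d. $\mathrm{Bernoulli}(1/2)$ random variables, let $Y_i=\begin{pmatrix}\epsilon_i&1\\1&0\end{pmatrix}$, $S_n=Y_n\cdots Y_1$, and let $\lambda=\lim_{n\to\infty}\frac1n\mathbb{E}[\log\|S_n\|]$ be the top Lyapunov exponent. For each integer $n\ge0$ set \[ p_n=\frac{\log c_n}{(n+7)2^n},\qquad q_n=\frac{\log c_n}{(n+4)2^n}. \] Then $p_n\le \lambda\le q_n$ for every $n\ge0$, and $\lim_{n\to\infty}p_n=\lim_{n\to\infty}q_n=\lambda$.
   Context: $\mathrm{Bernoulli}(1/2)$ means $\mathbb{P}(\epsilon=1)=\mathbb{P}(\epsilon=0)=1/2$. $\|\cdot\|$ is any matrix norm. The integers $a_n^k,b_n^k$ ($n\ge0$, $1\le k\le 2^n$) are defined recursively by $a_0^1=2$, $b_0^1=1$ and, for $n\ge 0$, $(a_{n+1}^k,b_{n+1}^k)=(a_n^k+b_n^k,\ a_n^k)$ for $k=1,\dots,2^n$, and $(a_{n+1}^k,b_{n+1}^k)=(b_n^{k-2^n},\ a_n^{k-2^n})$ for $k=2^n+1,\dots,2^{n+1}$. For $n\ge0$, $c_n:=\prod_{k=1}^{2^n}(a_n^k+b_n^k)$. It is known that $\lambda=\mathbb{E}[\log X]$, where $X$ is a $(0,\infty)$-valued random variable with atomless law, uniquely determined by $X\sim\frac1X+\epsilon$ with $\epsilon\sim\mathrm{Bernoulli}(1/2)$ independent of $X$. *)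

(* Defs.v *)
From Stdlib Require Import Reals List.
Import ListNotations.
Open Scope R_scope.

Record mat2 := Mat2 { m11 : R; m12 : R; m21 : R; m22 : R }.

Definition mat2_zero : mat2 := Mat2 0 0 0 0.
Definition mat2_id : mat2 := Mat2 1 0 0 1.
Definition mat2_add (A B : mat2) : mat2 :=
  Mat2 (m11 A + m11 B) (m12 A + m12 B) (m21 A + m21 B) (m22 A + m22 B).
Definition mat2_scale (c : R) (A : mat2) : mat2 :=
  Mat2 (c * m11 A) (c * m12 A) (c * m21 A) (c * m22 A).
Definition mat2_mul (A B : mat2) : mat2 :=
  Mat2 (m11 A * m11 B + m12 A * m21 B) (m11 A * m12 B + m12 A * m22 B)
       (m21 A * m11 B + m22 A * m21 B) (m21 A * m12 B + m22 A * m22 B).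

Definition is_mat_norm (N : mat2 -> R) : Prop :=
  (forall A, 0 <= N A) /\
  (forall A, N A = 0 -> A = mat2_zero) /\
  (forall c A, N (mat2_scale c A) = Rabs c * N A) /\
  (forall A B, N (mat2_add A B) <= N A + N B).

Definition Ymat (e : bool) : mat2 := Mat2 (if e then 1 else 0) 1 1 0.

Definition Sprod (l : list bool) : mat2 :=
  fold_left (fun M e => mat2_mul (Ymat e) M) l mat2_id.

Fixpoint bitseqs (n : nat) : list (list bool) :=
  match n with
  | O => [[]]
  | S k => map (cons false) (bitseqs k) ++ map (cons true) (bitseqs k)
  end.

Definition sumR (l : list R) : R := fold_right Rplus 0 l.

Definition ElogS (N : mat2 -> R) (n : nat) : R :=
  sumR (map (fun l => ln (N (Sprod l))) (bitseqs n)) / 2 ^ n.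

Fixpoint ab_list (n : nat) : list (nat * nat) :=
  match n with
  | O => [(2%nat, 1%nat)]
  | S k => map (fun p => (fst p + snd p, fst p)%nat) (ab_list k)
           ++ map (fun p => (snd p, fst p)) (ab_list k)
  end.

Definition c_seq (n : nat) : nat :=
  fold_right Nat.mul 1%nat (map (fun p => (fst p + snd p)%nat) (ab_list n)).

Definition p_seq (n : nat) : R := ln (INR (c_seq n)) / ((INR n + 7) * 2 ^ n).
Definition q_seq (n : nat) : R := ln (INR (c_seq n)) / ((INR n + 4) * 2 ^ n).

(* Main.v *)
(** Put [T f (x,y) = (f (x+y,x) + f (y,x)) / 2], [U_n = T^n (ln (x+y)) (2,1)] and [B_n = T^n (ln y) (2,1)]. Then [U_n = 2 B_(n+2) - B_n] and [ln c_n = 2^n U_n].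

The stationary variable [X] of the paper satisfies [E ln (X+1) = 4 lambda] and [E ln (1+1/X) = 3 lambda]. Conditioning [S_n] on an independent start [(X,1)] or [(X+1, 1+1/X)] therefore gives means [(n+4) lambda] and [(n+7) lambda]. Concavity of [ln |S_n (x,1)|] in [x] and [E X <= 2] make the first at most [U_n]; convexity of [ln |S_n (x+1, 1+1/x)|] in [ln x] makes the second at least [U_n].

Here [X] is replaced by the ratio [x/y] after [m] steps started from [(2,1)], and stationarity by averaging over [m < M] and letting [M] tend to infinity: the increments [B_(m+k) - B_m] have Cesaro limit [k lambda]. Existence of [lambda] comes from [U_(n+m) <= U_n + B_m] and Fekete's argument. Any norm is comparable with the entry sum, which on the nonnegative matrices [S_n] is comparable with [|S_n (2,1)|]. *)

Require Import Defs.
From Stdlib Require Import Reals List Lra Lia ClassicalEpsilon.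
From Coquelicot Require Import Coquelicot.
Import ListNotations.
Open Scope R_scope.

(** * Comparison of norms *)

Record is_seminorm (p : mat2 -> R) : Prop := Seminorm {
  seminorm_ge0 : forall A, 0 <= p A;
  seminorm_scale : forall c A, p (mat2_scale c A) = Rabs c * p A;
  seminorm_add : forall A B, p (mat2_add A B) <= p A + p B }.

Ltac mat_ring :=
  repeat match goal with A : mat2 |- _ => destruct A end;
  unfold mat2_zero, mat2_add, mat2_scale; simpl; f_equal; ring.

Lemma seminorm_line_lipschitz p v f s t : is_seminorm p ->
  p (mat2_add v (mat2_scale s f)) <=
  p (mat2_add v (mat2_scale t f)) + Rabs (s - t) * p f.
Proof.
intros Hp.
replace (mat2_add v (mat2_scale s f)) with
  (mat2_add (mat2_add v (mat2_scale t f)) (mat2_scale (s - t) f)) by mat_ring.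
rewrite <- (seminorm_scale _ Hp). apply (seminorm_add _ Hp).
Qed.

(** Along the line the seminorm is Lipschitz. If [p f = 0] it is constant; otherwise it is large far
    out, and a minimum over a compact interval is global. *)
Lemma seminorm_line_min p v f : is_seminorm p ->
  exists s, forall t,
    p (mat2_add v (mat2_scale s f)) <= p (mat2_add v (mat2_scale t f)).
Proof.
intros Hp.
set (g := fun t => p (mat2_add v (mat2_scale t f))).
assert (Hlip : forall s t, g s <= g t + Rabs (s - t) * p f)
  by (intros; apply seminorm_line_lipschitz; auto).
destruct (Rle_lt_or_eq_dec _ _ (seminorm_ge0 _ Hp f)) as [Hf | Hf].
2:{ exists 0. intros t. specialize (Hlip 0 t). rewrite <- Hf in Hlip.
    unfold g in Hlip. lra. }
assert (Hcont : continuity g).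
{ intros x e He. exists (e / p f). split.
  { apply Rdiv_lt_0_compat; lra. }
  intros y [_ Hy]. unfold Rdist, dist in *. simpl in *. unfold Rdist in *.
  assert (Rabs (y - x) * p f < e).
  { apply Rmult_lt_reg_r with (/ p f); [now apply Rinv_0_lt_compat |].
    replace (Rabs (y - x) * p f * / p f) with (Rabs (y - x)) by (field; lra).
    exact Hy. }
  pose proof (Hlip y x). pose proof (Hlip x y).
  rewrite (Rabs_minus_sym x y) in *. apply Rabs_def1; lra. }
pose proof (seminorm_ge0 _ Hp v) as Hv.
(* Outside [[-K, K]] the triangle inequality gives [g t >= Rabs t * p f - p v >= p v = g 0]. *)
set (K := 2 * p v / p f).
assert (HK : 0 <= K) by (apply Rdiv_le_0_compat; lra).
assert (HKf : K * p f = 2 * p v) by (unfold K; field; lra).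
destruct (continuity_ab_min g (- K) K) as [s [Hs _]]; [lra | auto |].
assert (Hg0 : g 0 = p v) by (unfold g; f_equal; mat_ring).
exists s. intros t. change (g s <= g t).
destruct (Rle_dec (Rabs t) K) as [Ht | Ht].
{ now apply Hs, Rabs_le_between. }
apply Rle_trans with (g 0); [apply Hs; lra |].
assert (Rabs t * p f <= g t + p v).
{ rewrite <- (seminorm_scale _ Hp).
  replace (mat2_scale t f) with
    (mat2_add (mat2_add v (mat2_scale t f)) (mat2_scale (-1) v)) by mat_ring.
  eapply Rle_trans; [apply (seminorm_add _ Hp) |].
  rewrite (seminorm_scale _ Hp), Rabs_m1. unfold g. lra. }
assert (K * p f <= Rabs t * p f) by (apply Rmult_le_compat_r; lra).
lra.
Qed.

(* The minimum over a line is attained, so no nonzero vector outside the line becomes null: this carries definiteness through the induction on dimension. *)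
Lemma quotient_seminorm p f : is_seminorm p ->
  exists q, is_seminorm q /\
    (forall v t, q v <= p (mat2_add v (mat2_scale t f))) /\
    (forall v, exists s, q v = p (mat2_add v (mat2_scale s f))).
Proof.
intros Hp.
set (s := fun v => epsilon (inhabits 0) (fun s => forall t,
    p (mat2_add v (mat2_scale s f)) <= p (mat2_add v (mat2_scale t f)))).
set (q := fun v => p (mat2_add v (mat2_scale (s v) f))).
assert (Hq : forall v t, q v <= p (mat2_add v (mat2_scale t f))).
{ intros v. unfold q, s.
  exact (epsilon_spec (inhabits 0) _ (seminorm_line_min p v f Hp)). }
assert (Hq0 : forall v, 0 <= q v) by (intros; apply (seminorm_ge0 _ Hp)).
exists q. repeat split; eauto.
- intros c v. destruct (Req_dec c 0) as [-> | Hc].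
  + rewrite Rabs_R0, Rmult_0_l. apply Rle_antisym; [| auto].
    eapply Rle_trans; [apply (Hq _ 0) |].
    replace (mat2_add _ _) with (mat2_scale 0 v) by mat_ring.
    rewrite (seminorm_scale _ Hp), Rabs_R0. lra.
  + apply Rle_antisym.
    * unfold q at 2. rewrite <- (seminorm_scale _ Hp).
      replace (mat2_scale c (mat2_add v (mat2_scale (s v) f))) with
        (mat2_add (mat2_scale c v) (mat2_scale (c * s v) f)) by mat_ring.
      apply Hq.
    * unfold q at 2.
      replace (mat2_add (mat2_scale c v) (mat2_scale (s (mat2_scale c v)) f)) with
        (mat2_scale c (mat2_add v (mat2_scale (s (mat2_scale c v) / c) f))).
      { rewrite (seminorm_scale _ Hp). apply Rmult_le_compat_l; [apply Rabs_pos | apply Hq]. }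
      destruct v, f; unfold mat2_add, mat2_scale; simpl; f_equal; field; auto.
- intros u v. eapply Rle_trans; [apply (Hq _ (s u + s v)) |].
  replace (mat2_add (mat2_add u v) (mat2_scale (s u + s v) f)) with
    (mat2_add (mat2_add u (mat2_scale (s u) f)) (mat2_add v (mat2_scale (s v) f)))
    by mat_ring.
  apply (seminorm_add _ Hp).
- intros v. now exists (s v).
Qed.

Fixpoint in_span (fs : list mat2) (A : mat2) : Prop :=
  match fs with
  | [] => A = mat2_zero
  | f :: fs => exists t B, in_span fs B /\ A = mat2_add (mat2_scale t f) B
  end.

Lemma in_span_scale fs c A : in_span fs A -> in_span fs (mat2_scale c A).
Proof.
revert A; induction fs as [| f fs IH]; simpl; intros A.
- intros ->. mat_ring.
- intros (t & B & HB & ->). exists (c * t), (mat2_scale c B). split; [auto |]. mat_ring.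
Qed.

(** Each vector [f] of the list is absorbed into the quotient seminorm [q], which stays nonzero on
    the remaining affine space because its minimum is attained. A gap for [q] is a gap for [p], as
    [q] lies below [p] along [f]. *)
Lemma seminorm_affine_gap fs p v : is_seminorm p ->
  (forall B, in_span fs B -> p (mat2_add v B) <> 0) ->
  exists d, 0 < d /\ forall B, in_span fs B -> d <= p (mat2_add v B).
Proof.
revert p; induction fs as [| f fs IH]; intros p Hp Hv.
- exists (p (mat2_add v mat2_zero)). split.
  + pose proof (seminorm_ge0 _ Hp (mat2_add v mat2_zero)).
    specialize (Hv _ eq_refl). lra.
  + intros B ->. lra.
- destruct (quotient_seminorm p f Hp) as (q & Hq & Hqle & Hqeq).
  destruct (IH q Hq) as (d & Hd & HB).
  + intros B HB. destruct (Hqeq (mat2_add v B)) as [s ->].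
    replace (mat2_add (mat2_add v B) (mat2_scale s f)) with
      (mat2_add v (mat2_add (mat2_scale s f) B)) by mat_ring.
    apply Hv. now exists s, B.
  + exists d. split; [auto |]. intros A (t & B & HB' & ->).
    eapply Rle_trans; [apply (HB B HB') |].
    eapply Rle_trans; [apply (Hqle _ t) |].
    right. f_equal. mat_ring.
Qed.

(** Homogeneity reduces to [t = 1], where the gap between [e] and the span of [fs] applies. *)
Lemma norm_ge_coordinate N e fs : is_mat_norm N ->
  (forall B, in_span fs B -> mat2_add e B <> mat2_zero) ->
  exists d, 0 < d /\
    forall t B, in_span fs B -> d * Rabs t <= N (mat2_add (mat2_scale t e) B).
Proof.
intros (Hpos & Hdef & Hsc & Hadd) Hind.
destruct (seminorm_affine_gap fs N e) as (d & Hd & Hgap).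
{ now split. }
{ intros B HB H0. apply (Hind B HB). auto. }
exists d. split; [auto |]. intros t B HB.
destruct (Req_dec t 0) as [-> | Ht].
{ rewrite Rabs_R0, Rmult_0_r. auto. }
replace (mat2_add (mat2_scale t e) B) with
  (mat2_scale t (mat2_add e (mat2_scale (/ t) B))).
{ rewrite Hsc, Rmult_comm. apply Rmult_le_compat_l; [apply Rabs_pos |].
  apply Hgap. now apply in_span_scale. }
destruct e, B; unfold mat2_add, mat2_scale; simpl; f_equal; field; auto.
Qed.

Definition entry_sum (A : mat2) : R :=
  Rabs (m11 A) + Rabs (m12 A) + Rabs (m21 A) + Rabs (m22 A).

Lemma norm_le_entry_sum N : is_mat_norm N ->
  exists C, 0 < C /\ forall A, N A <= C * entry_sum A.
Proof.
intros (Hpos & Hdef & Hsc & Hadd).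
set (E1 := Mat2 1 0 0 0). set (E2 := Mat2 0 1 0 0).
set (E3 := Mat2 0 0 1 0). set (E4 := Mat2 0 0 0 1).
exists (1 + N E1 + N E2 + N E3 + N E4). split.
{ pose proof (Hpos E1). pose proof (Hpos E2). pose proof (Hpos E3). pose proof (Hpos E4). lra. }
intros A.
replace A with (mat2_add (mat2_scale (m11 A) E1) (mat2_add (mat2_scale (m12 A) E2)
   (mat2_add (mat2_scale (m21 A) E3) (mat2_scale (m22 A) E4)))) at 1
  by (subst E1 E2 E3 E4; mat_ring).
eapply Rle_trans; [apply Hadd |]. rewrite Hsc.
eapply Rle_trans; [apply Rplus_le_compat_l, Hadd |]. rewrite Hsc.
eapply Rle_trans; [apply Rplus_le_compat_l, Rplus_le_compat_l, Hadd |]. rewrite !Hsc.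
unfold entry_sum.
pose proof (Hpos E1). pose proof (Hpos E2). pose proof (Hpos E3). pose proof (Hpos E4).
pose proof (Rabs_pos (m11 A)). pose proof (Rabs_pos (m12 A)).
pose proof (Rabs_pos (m21 A)). pose proof (Rabs_pos (m22 A)).
nra.
Qed.

Ltac indep :=
  intros B (t1 & B1 & (t2 & B2 & (t3 & B3 & -> & ->) & ->) & ->);
  unfold mat2_add, mat2_scale, mat2_zero; simpl; intros HB; injection HB; lra.

Lemma norm_ge_entry_sum N : is_mat_norm N ->
  exists c, 0 < c /\ forall A, c * entry_sum A <= N A.
Proof.
intros HN.
set (E1 := Mat2 1 0 0 0). set (E2 := Mat2 0 1 0 0).
set (E3 := Mat2 0 0 1 0). set (E4 := Mat2 0 0 0 1).
assert (Hspan : forall F1 F2 F3 s t u, in_span [F1; F2; F3]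
  (mat2_add (mat2_scale s F1) (mat2_add (mat2_scale t F2)
    (mat2_add (mat2_scale u F3) mat2_zero)))).
{ intros. simpl. do 2 eexists. split; [| reflexivity].
  do 2 eexists. split; [| reflexivity]. do 2 eexists. split; reflexivity. }
destruct (norm_ge_coordinate N E1 [E2; E3; E4] HN) as (d1 & Hd1 & H1); [indep |].
destruct (norm_ge_coordinate N E2 [E1; E3; E4] HN) as (d2 & Hd2 & H2); [indep |].
destruct (norm_ge_coordinate N E3 [E1; E2; E4] HN) as (d3 & Hd3 & H3); [indep |].
destruct (norm_ge_coordinate N E4 [E1; E2; E3] HN) as (d4 & Hd4 & H4); [indep |].
(* Each entry is at most [/ di * N A] in absolute value; the four bounds are summed. *)
exists (/ (/ d1 + / d2 + / d3 + / d4)).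
assert (Hpos : 0 < / d1 + / d2 + / d3 + / d4).
{ repeat apply Rplus_lt_0_compat; now apply Rinv_0_lt_compat. }
split; [now apply Rinv_0_lt_compat |]. intros A.
assert (Hdiv : forall d t, 0 < d -> d * Rabs t <= N A -> Rabs t <= / d * N A).
{ intros d t Hd H. apply Rmult_le_reg_l with d; [auto |].
  replace (d * (/ d * N A)) with (N A) by (field; lra). auto. }
assert (K1 := H1 (m11 A) _ (Hspan E2 E3 E4 (m12 A) (m21 A) (m22 A))).
assert (K2 := H2 (m12 A) _ (Hspan E1 E3 E4 (m11 A) (m21 A) (m22 A))).
assert (K3 := H3 (m21 A) _ (Hspan E1 E2 E4 (m11 A) (m12 A) (m22 A))).
assert (K4 := H4 (m22 A) _ (Hspan E1 E2 E3 (m11 A) (m12 A) (m21 A))).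
replace (mat2_add _ _) with A in K1 by (subst E1 E2 E3 E4; mat_ring).
replace (mat2_add _ _) with A in K2 by (subst E1 E2 E3 E4; mat_ring).
replace (mat2_add _ _) with A in K3 by (subst E1 E2 E3 E4; mat_ring).
replace (mat2_add _ _) with A in K4 by (subst E1 E2 E3 E4; mat_ring).
apply Hdiv in K1; apply Hdiv in K2; apply Hdiv in K3; apply Hdiv in K4; auto.
apply Rmult_le_reg_l with (/ d1 + / d2 + / d3 + / d4); [auto |].
rewrite <- Rmult_assoc, Rinv_r, Rmult_1_l by lra.
unfold entry_sum. lra.
Qed.

(** * The transfer operator *)

(** The two arguments of [f] are the images of the column [(x, y)] under [Ymat true] and
    [Ymat false], so the [n]-th iterate is the mean of [f] at [S_n (x, y)]. *)
Definition transfer (f : R -> R -> R) (x y : R) : R := (f (x + y) x + f y x) / 2.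

Definition transfer_iter (n : nat) (f : R -> R -> R) : R -> R -> R :=
  Nat.iter n transfer f.

Definition ln_fst (x y : R) : R := ln x.
Definition ln_snd (x y : R) : R := ln y.
Definition ln_sum (x y : R) : R := ln (x + y).

Lemma transfer_iter_S n f x y :
  transfer_iter (S n) f x y =
  (transfer_iter n f (x + y) x + transfer_iter n f y x) / 2.
Proof. reflexivity. Qed.

Lemma transfer_iter_swap n f :
  transfer_iter (S n) f = transfer_iter n (transfer f).
Proof. apply Nat.iter_succ_r. Qed.

Lemma transfer_iter_plus n m f :
  transfer_iter (n + m) f = transfer_iter n (transfer_iter m f).
Proof. apply Nat.iter_add. Qed.

Lemma transfer_iter_le n f g x y : 0 < x -> 0 < y ->
  (forall x y, 0 < x -> 0 < y -> f x y <= g x y) ->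
  transfer_iter n f x y <= transfer_iter n g x y.
Proof.
intros Hx Hy Hfg; revert x y Hx Hy; induction n as [| n IH]; intros x y Hx Hy.
- now apply Hfg.
- rewrite !transfer_iter_S.
  pose proof (IH (x + y) x ltac:(lra) Hx). pose proof (IH y x Hy Hx). lra.
Qed.

Lemma transfer_iter_ext n f g x y : 0 < x -> 0 < y ->
  (forall x y, 0 < x -> 0 < y -> f x y = g x y) ->
  transfer_iter n f x y = transfer_iter n g x y.
Proof.
intros Hx Hy Hfg. apply Rle_antisym; apply transfer_iter_le; auto;
  intros; rewrite Hfg; auto; lra.
Qed.

Lemma transfer_iter_lin n a f g x y :
  transfer_iter n (fun x y => a * f x y + g x y) x y =
  a * transfer_iter n f x y + transfer_iter n g x y.
Proof.
revert x y; induction n as [| n IH]; intros x y; [reflexivity |].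
rewrite !transfer_iter_S, !IH. lra.
Qed.

Lemma transfer_iter_const n c x y : transfer_iter n (fun _ _ => c) x y = c.
Proof.
revert x y; induction n as [| n IH]; intros x y; [reflexivity |].
rewrite transfer_iter_S, !IH. lra.
Qed.

Lemma transfer_iter_add n f g x y :
  transfer_iter n (fun x y => f x y + g x y) x y =
  transfer_iter n f x y + transfer_iter n g x y.
Proof.
revert x y; induction n as [| n IH]; intros x y; [reflexivity |].
rewrite !transfer_iter_S, !IH. lra.
Qed.

(** Linearity of the matrix action lets a starting point be rescaled so that only its ratio [x / y]
    matters, up to an additive logarithm. *)
Lemma transfer_iter_ln_sum_homogeneous n c x y : 0 < c -> 0 < x -> 0 < y ->
  transfer_iter n ln_sum (c * x) (c * y) = ln c + transfer_iter n ln_sum x y.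
Proof.
intros Hc; revert x y; induction n as [| n IH]; intros x y Hx Hy.
- unfold transfer_iter, ln_sum; simpl. rewrite <- ln_mult by lra. f_equal; ring.
- rewrite !transfer_iter_S, <- Rmult_plus_distr_l, !IH by lra. lra.
Qed.

Lemma ln_le_sub_1 x : 0 < x -> ln x <= x - 1.
Proof.
intros Hx. pose proof (exp_ineq1_le (ln x)). rewrite exp_ln in *; lra.
Qed.

Lemma ln_le_tangent x y : 0 < x -> 0 < y -> ln x <= ln y + x / y - 1.
Proof.
intros Hx Hy. pose proof (ln_le_sub_1 (x / y) ltac:(now apply Rdiv_lt_0_compat)).
rewrite ln_div in *; lra.
Qed.

(* Tangent plane at [(x0, y0)] of a concave function that is [ln] of a positively 1-homogeneous one; Euler's identity gives [al * x0 + be * y0 = 1]. *)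
Lemma transfer_iter_ln_sum_tangent n x0 y0 : 0 < x0 -> 0 < y0 ->
  exists al be, 0 <= al /\ 0 <= be /\ al * x0 + be * y0 = 1 /\
    forall x y, 0 < x -> 0 < y ->
      transfer_iter n ln_sum x y <=
      transfer_iter n ln_sum x0 y0 + al * x + be * y - 1.
Proof.
revert x0 y0; induction n as [| n IH]; intros x0 y0 Hx0 Hy0.
- assert (0 < / (x0 + y0)) by (apply Rinv_0_lt_compat; lra).
  exists (/ (x0 + y0)), (/ (x0 + y0)). repeat split; try lra.
  + field; lra.
  + intros x y Hx Hy. unfold transfer_iter, ln_sum; simpl.
    pose proof (ln_le_tangent (x + y) (x0 + y0) ltac:(lra) ltac:(lra)).
    unfold Rdiv in *. lra.
- destruct (IH (x0 + y0) x0) as (a1 & b1 & Ha1 & Hb1 & H1 & T1); try lra.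
  destruct (IH y0 x0) as (a0 & b0 & Ha0 & Hb0 & H0 & T0); try lra.
  exists ((a1 + b1 + b0) / 2), ((a1 + a0) / 2). repeat split; try lra.
  intros x y Hx Hy. rewrite !transfer_iter_S.
  pose proof (T1 (x + y) x ltac:(lra) Hx). pose proof (T0 y x Hy Hx). lra.
Qed.

(** The right side is convex in [ln x]; its slope at [ln x = 0] is [(p - s) / (2 * (p + s))], which
    is the coefficient of [ln x] on the left. *)
Lemma ln_sum_geometric_mean p s x : 0 <= p -> 0 <= s -> 0 < p + s -> 0 < x ->
  ln (2 * p + s) + s / (2 * (p + s)) + (1 / 2 - 2 * (s / (2 * (p + s)))) * ln x <=
  ln (x * p + (p + s) + s / x).
Proof.
intros Hp Hs Hps Hx.
set (k := s / (2 * (p + s))).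
assert (Hs' : s = 2 * (p + s) * k) by (unfold k; field; lra).
set (Z := x * p + (p + s) + s / x).
assert (HZ : 0 < Z).
{ assert (0 <= x * p) by nra. assert (0 <= s / x) by (apply Rdiv_le_0_compat; lra).
  unfold Z; lra. }
(* Weighted AM-GM for the three summands of [Z], with the weights they have at [x = 1]. *)
assert (Hl : ln (2 * (p + s)) + (1 / 2 - 2 * k) * ln x <= ln Z).
{ pose proof (ln_le_tangent (2 * (p + s) * x) Z ltac:(nra) HZ) as T1.
  pose proof (ln_le_tangent (2 * (p + s)) Z ltac:(lra) HZ) as T2.
  pose proof (ln_le_tangent (2 * (p + s) / x) Z
    ltac:(apply Rdiv_lt_0_compat; lra) HZ) as T3.
  rewrite ln_mult in T1 by lra. rewrite ln_div in T3 by lra.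
  assert (Hk : 0 <= k) by (apply Rdiv_le_0_compat; lra).
  assert (Hk' : k <= 1 / 2).
  { apply Rmult_le_reg_l with (2 * (p + s)); [lra |]. rewrite <- Hs'. lra. }
  assert (HW : (1 / 2 - k) * (2 * (p + s) * x / Z) + / 2 * (2 * (p + s) / Z)
    + k * (2 * (p + s) / x / Z) = 1).
  { apply Rmult_eq_reg_r with Z; [| lra].
    replace (((1 / 2 - k) * (2 * (p + s) * x / Z) + / 2 * (2 * (p + s) / Z)
      + k * (2 * (p + s) / x / Z)) * Z) with
      ((p + s) * x - (2 * (p + s) * k) * x + (p + s) + (2 * (p + s) * k) / x)
      by (field; lra).
    rewrite <- Hs'. unfold Z. lra. }
  apply (Rmult_le_compat_l (1 / 2 - k)) in T1; [| lra].
  apply (Rmult_le_compat_l k) in T3; [| lra].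
  nra. }
(* The value [ln (2 * (p + s))] at [x = 1] exceeds [ln (2 * p + s)] by at least [k], since the
   quotient is [1 - k]. *)
pose proof (ln_le_tangent (2 * p + s) (2 * (p + s)) ltac:(lra) ltac:(lra)) as T.
replace ((2 * p + s) / (2 * (p + s))) with (1 - k) in T by (unfold k; field; lra).
lra.
Qed.

(** With rows [(p1, s1)] and [(p2, s2)] of a nonnegative matrix, the right side starts from the
    image of [(x + 1, 1 + 1 / x)] and the left from the image of [(2, 1)]. One [k] serves all [x]:
    the base case uses the column sums, and each step averages the two values of [k]. *)
Lemma transfer_iter_ln_sum_log_convex n p1 p2 s1 s2 :
  0 <= p1 -> 0 <= p2 -> 0 <= s1 -> 0 <= s2 -> 0 < p1 + s1 -> 0 < p2 + s2 ->
  exists k, 0 <= k <= 1 / 2 /\ forall x, 0 < x ->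
    transfer_iter n ln_sum (2 * p1 + s1) (2 * p2 + s2) + k
      + (1 / 2 - 2 * k) * ln x <=
    transfer_iter n ln_sum (x * p1 + (p1 + s1) + s1 / x)
                           (x * p2 + (p2 + s2) + s2 / x).
Proof.
revert p1 p2 s1 s2; induction n as [| n IH]; intros p1 p2 s1 s2 Hp1 Hp2 Hs1 Hs2 H1 H2.
- exists ((s1 + s2) / (2 * (p1 + p2 + (s1 + s2)))). split.
  + split; [apply Rdiv_le_0_compat; lra |].
    apply Rmult_le_reg_r with (2 * (p1 + p2 + (s1 + s2))); [lra |].
    unfold Rdiv at 1. rewrite Rmult_assoc, Rinv_l by lra. lra.
  + intros x Hx. unfold transfer_iter, ln_sum; simpl.
    replace (2 * p1 + s1 + (2 * p2 + s2)) with (2 * (p1 + p2) + (s1 + s2)) by ring.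
    replace (_ + _ + s1 / x + _) with
      (x * (p1 + p2) + (p1 + p2 + (s1 + s2)) + (s1 + s2) / x) by (field; lra).
    apply ln_sum_geometric_mean; lra.
- destruct (IH (p1 + p2) p1 (s1 + s2) s1) as (k1 & Hk1 & T1); try lra.
  destruct (IH p2 p1 s2 s1) as (k0 & Hk0 & T0); try lra.
  exists ((k1 + k0) / 2). split; [lra |]. intros x Hx. rewrite !transfer_iter_S.
  specialize (T1 x Hx). specialize (T0 x Hx).
  replace (2 * p1 + s1 + (2 * p2 + s2)) with (2 * (p1 + p2) + (s1 + s2)) by ring.
  replace (x * p1 + (p1 + s1) + s1 / x + (x * p2 + (p2 + s2) + s2 / x)) with
    (x * (p1 + p2) + (p1 + p2 + (s1 + s2)) + (s1 + s2) / x) by (field; lra).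
  lra.
Qed.

(** * Logarithmic means started from (2, 1) *)

Definition log_sum_mean (n : nat) : R := transfer_iter n ln_sum 2 1.
Definition log_snd_mean (n : nat) : R := transfer_iter n ln_snd 2 1.

(** After either step the second coordinate is the old first one. *)
Lemma transfer_iter_ln_fst n : transfer_iter n ln_fst 2 1 = log_snd_mean (S n).
Proof.
unfold log_snd_mean. rewrite transfer_iter_swap.
apply transfer_iter_ext; try lra. intros. unfold transfer, ln_fst, ln_snd. lra.
Qed.

(** The first coordinate becomes [x + y] or [y], so [transfer ln_fst] is half of [ln_sum] plus half
    of [ln_snd]. *)
Lemma log_sum_mean_eq n :
  log_sum_mean n = 2 * log_snd_mean (S (S n)) - log_snd_mean n.
Proof.
rewrite <- (transfer_iter_ln_fst (S n)), transfer_iter_swap.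
rewrite (transfer_iter_ext n _ (fun x y => / 2 * ln_sum x y + / 2 * ln_snd x y)) by
  (try lra; intros; unfold transfer, ln_fst, ln_sum, ln_snd; lra).
rewrite transfer_iter_lin.
rewrite (transfer_iter_ext n (fun x y => / 2 * ln_snd x y)
  (fun x y => / 2 * ln_snd x y + 0)) by (intros; lra).
rewrite transfer_iter_lin, transfer_iter_const.
unfold log_sum_mean, log_snd_mean. lra.
Qed.

(** One step turns [x / y] into an expression in [y / x], but two steps give at most
    [(x / y) / 2 + 1], which preserves the bound 2. Hence the induction carries two consecutive
    indices. *)
Lemma transfer_iter_ratio n :
  transfer_iter n Rdiv 2 1 <= 2 /\ transfer_iter (S n) Rdiv 2 1 <= 2.
Proof.
induction n as [| n [IH0 IH1]].
- unfold transfer_iter, transfer; simpl. lra.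
- split; [auto |]. rewrite !transfer_iter_swap.
  apply Rle_trans with (transfer_iter n (fun x y => / 2 * (x / y) + 1) 2 1).
  + apply transfer_iter_le; try lra. intros x y Hx Hy. unfold transfer.
    assert (x / (x + y) <= 1).
    { apply Rmult_le_reg_r with (x + y); [lra |].
      unfold Rdiv. rewrite Rmult_assoc, Rinv_l; lra. }
    replace (_ / 2) with ((1 + x / (x + y) + x / y) / 2) by (field; lra).
    lra.
  + rewrite transfer_iter_lin, transfer_iter_const.
    change (fun x y => x / y) with Rdiv. lra.
Qed.

(** After [m] steps the point is rescaled to [(x / y, 1)] and the tangent plane at [(2, 1)] is
    applied. It has nonnegative slope in [x / y], whose mean is at most 2, and Euler's identity
    cancels the constants. *)
Lemma log_sum_mean_plus_le n m :
  log_sum_mean (n + m) <= log_sum_mean n + log_snd_mean m.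
Proof.
unfold log_sum_mean, log_snd_mean. rewrite Nat.add_comm, transfer_iter_plus.
destruct (transfer_iter_ln_sum_tangent n 2 1) as (al & be & Hal & Hbe & He & T); try lra.
set (U := transfer_iter n ln_sum 2 1) in *.
apply Rle_trans with
  (transfer_iter m (fun x y => al * (x / y) + ((U + be - 1) + ln_snd x y)) 2 1).
- apply transfer_iter_le; try lra. intros x y Hx Hy.
  pose proof (T (x / y) 1 ltac:(now apply Rdiv_lt_0_compat) ltac:(lra)).
  replace x with (y * (x / y)) at 1 by (field; lra).
  replace y with (y * 1) at 3 by ring.
  rewrite transfer_iter_ln_sum_homogeneous by (auto using Rdiv_lt_0_compat, Rlt_0_1).
  unfold ln_snd. lra.
- rewrite transfer_iter_lin, transfer_iter_add, transfer_iter_const.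
  change (fun x y => x / y) with Rdiv.
  pose proof (proj1 (transfer_iter_ratio m)). nra.
Qed.

(** The log-convex bound for the identity matrix is averaged over the point reached after [m] steps,
    with [x / y] in place of [x]. *)
Lemma log_sum_mean_plus_ge n : exists k, 0 <= k <= 1 / 2 /\ forall m,
  log_sum_mean n + k + (1 / 2 - 2 * k) * (log_snd_mean (S m) - log_snd_mean m) <=
  log_sum_mean (n + m) + log_sum_mean m - log_snd_mean (S m) - log_snd_mean m.
Proof.
destruct (transfer_iter_ln_sum_log_convex n 1 0 0 1) as (k & Hk & T); try lra.
exists k; split; [auto |]. intros m.
replace (2 * 1 + 0) with 2 in T by ring. replace (2 * 0 + 1) with 1 in T by ring.
rewrite <- transfer_iter_ln_fst. unfold log_sum_mean, log_snd_mean.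
rewrite Nat.add_comm, transfer_iter_plus.
set (U := transfer_iter n ln_sum 2 1) in *.
assert (H : transfer_iter m (fun x y => (3 / 2 - 2 * k) * ln_fst x y +
    ((1 / 2 + 2 * k) * ln_snd x y + (U + k))) 2 1 <=
  transfer_iter m (fun x y => transfer_iter n ln_sum x y + ln_sum x y) 2 1).
{ apply transfer_iter_le; try lra. intros x y Hx Hy.
  specialize (T (x / y) ltac:(now apply Rdiv_lt_0_compat)).
  (* This factor rescales [(x, y)] to [(x / y + 1, 1 + y / x)]; the mean of its logarithm is
     [log_sum_mean m - log_snd_mean (S m) - log_snd_mean m]. *)
  assert (0 < (x + y) / (x * y)) by (apply Rdiv_lt_0_compat; nra).
  replace (x / y * 1 + (1 + 0) + 0 / (x / y)) with ((x + y) / (x * y) * x) in T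
    by (field; lra).
  replace (x / y * 0 + (0 + 1) + 1 / (x / y)) with ((x + y) / (x * y) * y) in T
    by (field; lra).
  rewrite transfer_iter_ln_sum_homogeneous in T by auto.
  rewrite !ln_div, ln_mult in T by nra.
  unfold ln_fst, ln_snd, ln_sum in *. lra. }
rewrite !transfer_iter_lin, transfer_iter_const, transfer_iter_add in H. lra.
Qed.

Lemma log_snd_mean_ge0 n : 0 <= log_snd_mean n.
Proof.
enough (H : forall x y, 1 <= x -> 1 <= y -> 0 <= transfer_iter n ln_snd x y)
  by (apply H; lra).
induction n as [| n IH]; intros x y Hx Hy.
- unfold transfer_iter, ln_snd; simpl. rewrite <- ln_1. apply ln_le; lra.
- rewrite transfer_iter_S.
  pose proof (IH (x + y) x ltac:(lra) Hx). pose proof (IH y x Hy Hx). lra.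
Qed.

Lemma log_snd_mean_le_sum n : log_snd_mean n <= log_sum_mean n.
Proof.
apply transfer_iter_le; try lra. intros x y Hx Hy.
unfold ln_snd, ln_sum. apply ln_le; lra.
Qed.

(** The increment is the mean of [ln (x / y)], at most the mean of [x / y - 1]. It yields the bound
    1 on the exponent. *)
Lemma log_snd_mean_S_le n : log_snd_mean (S n) <= log_snd_mean n + 1.
Proof.
rewrite <- transfer_iter_ln_fst.
apply Rle_trans with
  (transfer_iter n (fun x y => 1 * (x / y) + (ln_snd x y + -1)) 2 1).
- apply transfer_iter_le; try lra. intros x y Hx Hy.
  pose proof (ln_le_tangent x y Hx Hy). unfold ln_fst, ln_snd. lra.
- rewrite transfer_iter_lin, transfer_iter_add, transfer_iter_const.
  change (fun x y => x / y) with Rdiv.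
  pose proof (proj1 (transfer_iter_ratio n)). unfold log_snd_mean. lra.
Qed.

(** * Limits *)

Lemma is_lim_seq_inv_INR : is_lim_seq (fun n => / INR n) 0.
Proof.
apply (is_lim_seq_inv INR p_infty); [apply is_lim_seq_INR | discriminate].
Qed.

Lemma is_lim_seq_const_div_INR c : is_lim_seq (fun n => c / INR n) 0.
Proof.
replace (Finite 0) with (Rbar_mult c 0) by (simpl; f_equal; ring).
apply is_lim_seq_scal_l, is_lim_seq_inv_INR.
Qed.

(* Fekete's argument for [U], with [inf (B m / m)] as the limit. *)
Lemma fekete_pair (U B : nat -> R) :
  (forall n, 0 <= B n) -> (forall n, B n <= U n) ->
  (forall n m, U (n + m)%nat <= U n + B m) ->
  exists l : R, is_lim_seq (fun n => B n / INR n) l.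
Proof.
intros HB HBU Hsub.
set (E := fun r => exists m, (0 < m)%nat /\ r = - (B m / INR m)).
destruct (completeness E) as [s [Hub Hlub]].
{ exists 0. intros r (m & Hm & ->).
  assert (0 <= B m / INR m); [| lra].
  apply Rdiv_le_0_compat; [auto | now apply lt_0_INR]. }
{ exists (- (B 1%nat / INR 1)), 1%nat. split; [lia | reflexivity]. }
exists (- s).
assert (Hge : forall n, (0 < n)%nat -> - s <= B n / INR n).
{ intros n Hn. enough (- (B n / INR n) <= s) by lra. apply Hub. now exists n. }
apply is_lim_seq_Reals. intros e He.
destruct (classic (exists m, (0 < m)%nat /\ B m / INR m < - s + e / 2))
  as [(m & Hm & Hlt) | Hno].
2:{ exfalso. enough (s <= s - e / 2) by lra. apply Hlub.
    intros r (m & Hm & ->).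
    destruct (Rlt_dec (B m / INR m) (- s + e / 2)); [| lra].
    exfalso. apply Hno. now exists m. }
assert (HU1 : forall n, U n <= U 0%nat + INR n * B 1%nat).
{ induction n as [| n IH]; [simpl; lra |].
  pose proof (Hsub n 1%nat) as Hs. rewrite Nat.add_1_r in Hs. rewrite S_INR. lra. }
assert (Hmul : forall k n, U (n + k * m)%nat <= U n + INR k * B m).
{ induction k as [| k IH]; intros n.
  - rewrite Nat.add_0_r. simpl. lra.
  - replace (n + S k * m)%nat with ((n + k * m) + m)%nat by lia.
    pose proof (Hsub (n + k * m)%nat m). rewrite S_INR. specialize (IH n). lra. }
(* For [n = r + k * m] with [r < m], [C] bounds the remainder term [U r] uniformly; dividing by a
   large [n] makes it at most [e / 2]. *)
set (C := U 0%nat + INR m * B 1%nat).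
assert (HmR : 0 < INR m) by now apply lt_0_INR.
assert (HC : 0 <= C).
{ pose proof (HB 0%nat). pose proof (HBU 0%nat). pose proof (HB 1%nat). unfold C. nra. }
destruct (nfloor_ex (2 * C / e)) as [N0 HN0].
{ apply Rdiv_le_0_compat; lra. }
exists (S N0). intros n Hn.
assert (HnR : 2 * C / e < INR n).
{ apply Rlt_le_trans with (INR (S N0)); [rewrite S_INR; lra | apply le_INR; lia]. }
assert (Hn0 : 0 < INR n) by (apply lt_0_INR; lia).
assert (Hmain : B n <= C + INR n * (B m / INR m)).
{ pose proof (Nat.div_mod_eq n m) as Hdm. pose proof (Nat.mod_upper_bound n m ltac:(lia)) as Hr.
  set (k := (n / m)%nat) in *. set (r := (n mod m)%nat) in *.
  assert (Hn' : n = (r + k * m)%nat) by lia.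
  pose proof (Hmul k r) as Hk. rewrite <- Hn' in Hk.
  pose proof (HU1 r). pose proof (HB 1%nat). pose proof (HBU n).
  assert (INR r <= INR m) by (apply le_INR; lia).
  assert (INR r * B 1%nat <= INR m * B 1%nat) by (apply Rmult_le_compat_r; auto).
  assert (INR k * B m <= INR n * (B m / INR m)).
  { replace (INR k * B m) with (INR k * INR m * (B m / INR m)) by (field; lra).
    apply Rmult_le_compat_r; [apply Rdiv_le_0_compat; auto |].
    rewrite <- mult_INR. apply le_INR; lia. }
  unfold C. lra. }
assert (H1 : B n / INR n <= C / INR n + B m / INR m).
{ apply Rmult_le_reg_r with (INR n); [auto |].
  replace (B n / INR n * INR n) with (B n) by (field; lra).
  replace ((C / INR n + B m / INR m) * INR n) with (C + INR n * (B m / INR m))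
    by (field; lra).
  auto. }
assert (H2 : C / INR n <= e / 2).
{ apply Rmult_le_reg_r with (INR n * (2 / e)).
  { apply Rmult_lt_0_compat; [auto | apply Rdiv_lt_0_compat; lra]. }
  replace (C / INR n * (INR n * (2 / e))) with (2 * C / e) by (field; lra).
  replace (e / 2 * (INR n * (2 / e))) with (INR n) by (field; lra). lra. }
pose proof (Hge n ltac:(lia)). unfold Rdist. apply Rabs_def1; lra.
Qed.

(** * Cesàro averages *)

Fixpoint psum (f : nat -> R) (M : nat) : R :=
  match M with O => 0 | S M => psum f M + f M end.

Lemma psum_le f g M : (forall m, f m <= g m) -> psum f M <= psum g M.
Proof.
intros H; induction M as [| M IH]; simpl; [lra |]. specialize (H M). lra.
Qed.

Lemma psum_const c M : psum (fun _ => c) M = INR M * c.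
Proof. induction M as [| M IH]; simpl psum; [simpl; lra |]. rewrite S_INR, IH. lra. Qed.

Lemma psum_lin a f g M : psum (fun m => a * f m + g m) M = a * psum f M + psum g M.
Proof. induction M as [| M IH]; simpl; [lra |]. rewrite IH. lra. Qed.

Lemma psum_telescope B k M :
  psum (fun m => B (S (m + k)) - B (m + k)%nat) M = B (M + k)%nat - B k.
Proof. induction M as [| M IH]; simpl; [lra |]. rewrite IH. lra. Qed.

Definition cesaro_lim (f : nat -> R) (l : R) : Prop :=
  is_lim_seq (fun M => psum f M / INR M) l.

Lemma cesaro_lim_ext f g l : (forall m, f m = g m) -> cesaro_lim f l -> cesaro_lim g l.
Proof.
intros H. apply is_lim_seq_ext. intros M. f_equal.
apply Rle_antisym; apply psum_le; intros m; rewrite H; lra.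
Qed.

Lemma cesaro_lim_lin a f g lf lg : cesaro_lim f lf -> cesaro_lim g lg ->
  cesaro_lim (fun m => a * f m + g m) (a * lf + lg).
Proof.
intros Hf Hg. unfold cesaro_lim.
apply is_lim_seq_ext with (fun M => a * (psum f M / INR M) + psum g M / INR M).
{ intros M. rewrite psum_lin. unfold Rdiv. ring. }
apply is_lim_seq_plus'; [| auto]. now apply (is_lim_seq_scal_l _ a lf).
Qed.

Lemma cesaro_lim_ge c f l : cesaro_lim f l -> (forall m, c <= f m) -> c <= l.
Proof.
intros Hf Hc.
apply (is_lim_seq_le_loc (fun _ => c) (fun M => psum f M / INR M) c l); auto.
2: apply is_lim_seq_const.
exists 1%nat. intros M HM. assert (0 < INR M) by (apply lt_0_INR; lia).
apply Rmult_le_reg_r with (INR M); [auto |].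
replace (psum f M / INR M * INR M) with (psum f M) by (field; lra).
rewrite Rmult_comm, <- psum_const. now apply psum_le.
Qed.

Lemma is_lim_seq_shift_div_INR B (l : R) k :
  is_lim_seq (fun n => B n / INR n) l -> is_lim_seq (fun n => B (n + k)%nat / INR n) l.
Proof.
intros HB.
apply is_lim_seq_ext_loc with
  (fun n => B (n + k)%nat / INR (n + k) * (1 + INR k / INR n)).
{ exists 1%nat. intros n Hn. assert (0 < INR n) by (apply lt_0_INR; lia).
  pose proof (pos_INR k). rewrite plus_INR. field. lra. }
replace (Finite l) with (Finite (l * (1 + 0))) by (f_equal; ring).
apply is_lim_seq_mult'.
- now apply (is_lim_seq_incr_n (fun n => B n / INR n) k).
- apply is_lim_seq_plus'; [apply is_lim_seq_const | apply is_lim_seq_const_div_INR].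
Qed.

(** Unit increments telescope, so their averages tend to [l] even if the increments themselves do
    not converge; [k] of them are added. This stands in for stationarity. *)
Lemma cesaro_lim_increment B (l : R) k : is_lim_seq (fun n => B n / INR n) l ->
  cesaro_lim (fun m => B (m + k)%nat - B m) (INR k * l).
Proof.
intros HB; induction k as [| k IH].
- apply cesaro_lim_ext with (fun _ => 0).
  { intros m. rewrite Nat.add_0_r. lra. }
  simpl. rewrite Rmult_0_l. unfold cesaro_lim.
  apply is_lim_seq_ext with (fun _ => 0); [| apply is_lim_seq_const].
  intros M. rewrite psum_const. unfold Rdiv. ring.
- apply cesaro_lim_ext with
    (fun m => 1 * (B (m + k)%nat - B m) + (B (S (m + k)) - B (m + k)%nat)).
  { intros m. rewrite Nat.add_succ_r. lra. }
  replace (INR (S k) * l) with (1 * (INR k * l) + l) by (rewrite S_INR; ring).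
  apply cesaro_lim_lin; [auto |]. unfold cesaro_lim.
  apply is_lim_seq_ext with (fun M => B (M + k)%nat / INR M - B k / INR M).
  { intros M. rewrite psum_telescope. unfold Rdiv. ring. }
  replace (Finite l) with (Finite (l - 0)) by (f_equal; ring).
  apply is_lim_seq_minus'.
  + now apply is_lim_seq_shift_div_INR.
  + apply is_lim_seq_const_div_INR.
Qed.

(** The two restart inequalities are rewritten in increments [D k m] and averaged over [m]. The
    growth [2 * D (n + 2) - D n] averages to [(n + 4) * l], and the logarithm of the rescaling
    factor plus [B_m], namely [2 * D 2 - D 1], adds [3 * l]. *)
Lemma log_sum_mean_bounds (l : R) n :
  is_lim_seq (fun n => log_snd_mean n / INR n) l -> 0 <= l <= 1 ->
  (INR n + 4) * l <= log_sum_mean n <= (INR n + 7) * l.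
Proof.
intros HB Hl.
pose proof (fun k => cesaro_lim_increment _ _ k HB) as Hinc.
set (D := fun k m => log_snd_mean (m + k) - log_snd_mean m) in *.
(* [D 0] is the vanishing last summand that closes each chain of [cesaro_lim_lin]. *)
assert (HD0 : forall m, D 0%nat m = 0) by (intros; unfold D; rewrite Nat.add_0_r; lra).
assert (Hgrow : forall m, log_sum_mean (n + m) - log_snd_mean m =
    2 * D (n + 2)%nat m + (-1) * D n m).
{ intros m. rewrite log_sum_mean_eq. unfold D.
  replace (S (S (n + m))) with (m + (n + 2))%nat by lia.
  rewrite (Nat.add_comm n m). lra. }
split.
- enough (- log_sum_mean n <= - ((INR n + 4) * l)) by lra.
  apply cesaro_lim_ge with (fun m => (-2) * D (n + 2)%nat m + (1 * D n m + D 0%nat m)).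
  + replace (- ((INR n + 4) * l)) with
      ((-2) * (INR (n + 2) * l) + (1 * (INR n * l) + INR 0 * l))
      by (rewrite plus_INR; simpl; ring).
    do 2 (apply cesaro_lim_lin; [apply Hinc |]). apply Hinc.
  + intros m. pose proof (log_sum_mean_plus_le n m). specialize (Hgrow m).
    rewrite HD0. lra.
- destruct (log_sum_mean_plus_ge n) as (k & Hk & H).
  (* The tangent at [ln x = 0] leaves the slack [k * (1 - 2 * l) + l / 2], nonnegative as [0 <= l <= 1]. *)
  assert (log_sum_mean n + k <= (INR n + 7) * l + (2 * k - 1 / 2) * l); [| nra].
  (* The coefficient [2 * k - 3 / 2] collects [-1] from the rescaling and [-(1 / 2 - 2 * k)] from
     the tangent slope. *)
  apply cesaro_lim_ge with (fun m => 2 * D (n + 2)%nat m + ((-1) * D n m +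
    (2 * D 2%nat m + ((2 * k - 3 / 2) * D 1%nat m + D 0%nat m)))).
  + replace ((INR n + 7) * l + (2 * k - 1 / 2) * l) with
      (2 * (INR (n + 2) * l) + ((-1) * (INR n * l) +
      (2 * (INR 2 * l) + ((2 * k - 3 / 2) * (INR 1 * l) + INR 0 * l))))
      by (rewrite plus_INR; simpl; field).
    do 4 (apply cesaro_lim_lin; [apply Hinc |]). apply Hinc.
  + intros m. specialize (H m). specialize (Hgrow m). rewrite HD0.
    pose proof (log_sum_mean_eq m) as He. unfold D in *.
    replace (m + 2)%nat with (S (S m)) by lia. rewrite Nat.add_1_r. lra.
Qed.

Lemma log_snd_mean_lim :
  exists l : R, 0 <= l <= 1 /\ is_lim_seq (fun n => log_snd_mean n / INR n) l.
Proof.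
destruct (fekete_pair log_sum_mean log_snd_mean) as [l Hl];
  auto using log_snd_mean_ge0, log_snd_mean_le_sum, log_sum_mean_plus_le.
exists l. split; [| auto].
assert (Hinc : cesaro_lim (fun m => log_snd_mean (m + 1) - log_snd_mean m) l).
{ replace l with (INR 1 * l) by (simpl; ring). now apply cesaro_lim_increment. }
split.
- apply (is_lim_seq_le_loc (fun _ => 0) (fun n => log_snd_mean n / INR n) 0 l); auto.
  2: apply is_lim_seq_const.
  exists 1%nat. intros n Hn.
  apply Rdiv_le_0_compat; [apply log_snd_mean_ge0 | apply lt_0_INR; lia].
(* The increments are negated because [cesaro_lim_ge] transfers lower bounds only. *)
- enough (-1 <= (-1) * l + 0) by lra.
  apply cesaro_lim_ge with
    (fun m => (-1) * (log_snd_mean (m + 1) - log_snd_mean m) +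
      (log_snd_mean (m + 0) - log_snd_mean m)).
  + apply cesaro_lim_lin; [auto |].
    replace 0 with (INR 0 * l) by (simpl; ring). now apply cesaro_lim_increment.
  + intros m. rewrite Nat.add_1_r, Nat.add_0_r.
    pose proof (log_snd_mean_S_le m). lra.
Qed.

(** * Identification with the sequences of the theorem *)

Lemma sumR_app l1 l2 : sumR (l1 ++ l2) = sumR l1 + sumR l2.
Proof.
induction l1 as [| a l1 IH]; simpl; [lra |]. change (a + sumR (l1 ++ l2) = a + sumR l1 + sumR l2).
lra.
Qed.

Lemma sumR_map_plus {A} (f g : A -> R) l :
  sumR (map f l) + sumR (map g l) = sumR (map (fun a => f a + g a) l).
Proof.
induction l as [| a l IH]; unfold sumR in *; simpl; [lra |]. rewrite <- IH. lra.
Qed.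

Lemma sumR_map_scal {A} c (f : A -> R) l :
  sumR (map (fun a => c * f a) l) = c * sumR (map f l).
Proof.
induction l as [| a l IH]; unfold sumR in *; simpl; [lra |]. rewrite IH. lra.
Qed.

(** Each pair has its two images at the next level, whose values of [f] sum to [2 * transfer f]. The
    last step is thus moved onto [f], which is why [f] is general. *)
Lemma sumR_ab_list n f :
  sumR (map (fun p => f (INR (fst p)) (INR (snd p))) (ab_list n)) =
  2 ^ n * transfer_iter n f 2 1.
Proof.
revert f; induction n as [| n IH]; intros f.
- unfold transfer_iter; simpl. replace (1 + 1) with 2 by ring. lra.
- rewrite transfer_iter_swap. simpl ab_list.
  rewrite map_app, sumR_app, !map_map, sumR_map_plus.
  transitivity (sumR (map (fun p => 2 * transfer f (INR (fst p)) (INR (snd p))) (ab_list n))).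
  + f_equal. apply map_ext. intros p. simpl. rewrite plus_INR. unfold transfer. lra.
  + rewrite sumR_map_scal, IH. simpl. ring.
Qed.

Lemma ab_list_pos n p : In p (ab_list n) -> (0 < fst p /\ 0 < snd p)%nat.
Proof.
revert p; induction n as [| n IH]; simpl; intros p.
- intros [<- | []]; simpl; lia.
- rewrite in_app_iff, !in_map_iff.
  intros [(q & <- & Hq) | (q & <- & Hq)]; apply IH in Hq; simpl; lia.
Qed.

Lemma ln_c_seq n : ln (INR (c_seq n)) = 2 ^ n * log_sum_mean n.
Proof.
unfold log_sum_mean. rewrite <- sumR_ab_list. unfold c_seq.
pose proof (ab_list_pos n) as Hpos.
assert (H : 0 < INR (fold_right Nat.mul 1%nat
    (map (fun p => (fst p + snd p)%nat) (ab_list n))) /\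
  ln (INR (fold_right Nat.mul 1%nat (map (fun p => (fst p + snd p)%nat) (ab_list n)))) =
  sumR (map (fun p => ln_sum (INR (fst p)) (INR (snd p))) (ab_list n))).
{ induction (ab_list n) as [| p l IH]; simpl.
  - split; [lra | apply ln_1].
  - destruct IH as [IH1 IH2]; [intros; apply Hpos; now right |].
    destruct (Hpos p (or_introl eq_refl)) as [H1 H2].
    assert (0 < INR (fst p + snd p)) by (apply lt_0_INR; lia).
    rewrite mult_INR. split; [now apply Rmult_lt_0_compat |].
    rewrite ln_mult by auto. rewrite IH2, plus_INR. reflexivity. }
apply H.
Qed.

(** The second logarithm is that of the coordinate sum of [A (2, 1)], which lies between the entry
    sum of [A] and twice it. *)
Lemma norm_ln_close N : is_mat_norm N ->
  exists K, forall A, 0 <= m11 A -> 0 <= m12 A -> 0 <= m21 A -> 0 <= m22 A ->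
    0 < m11 A + m12 A + m21 A + m22 A ->
    Rabs (ln (N A) - ln (2 * m11 A + m12 A + (2 * m21 A + m22 A))) <= K.
Proof.
intros HN.
destruct (norm_le_entry_sum N HN) as (C & HC & HCN).
destruct (norm_ge_entry_sum N HN) as (c & Hc & HcN).
exists (Rabs (ln C) + Rabs (ln (c / 2))).
intros A H1 H2 H3 H4 Hs. specialize (HCN A). specialize (HcN A).
unfold entry_sum in *. rewrite !Rabs_pos_eq in HCN, HcN by auto.
set (s := m11 A + m12 A + m21 A + m22 A) in *.
set (v := 2 * m11 A + m12 A + (2 * m21 A + m22 A)).
assert (Hv1 : s <= v) by (unfold s, v; lra).
assert (Hv2 : v <= 2 * s) by (unfold s, v; lra).
assert (HNC : N A <= C * v) by nra.
assert (HNc : c / 2 * v <= N A) by nra.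
assert (0 < N A) by nra.
apply ln_le in HNC; [| auto].
apply ln_le in HNc; [| nra].
rewrite ln_mult in HNC, HNc by lra.
pose proof (Rle_abs (ln C)). pose proof (Rabs_pos (ln C)).
pose proof (Rabs_pos (ln (c / 2))).
pose proof (Rle_abs (- ln (c / 2))) as Hm. rewrite Rabs_Ropp in Hm.
apply Rabs_le. lra.
Qed.

Lemma ElogS_close N : is_mat_norm N ->
  exists K, forall n, Rabs (ElogS N n - log_sum_mean n) <= K.
Proof.
intros HN. destruct (norm_ln_close N HN) as [K HK]. exists K. intros n.
(* The identity is generalised to any nonzero nonnegative accumulator [A], since [fold_left]
   multiplies the first factor into it before recursing. *)
enough (H : forall A, 0 <= m11 A -> 0 <= m12 A -> 0 <= m21 A -> 0 <= m22 A ->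
    0 < m11 A + m12 A + m21 A + m22 A ->
    Rabs (sumR (map (fun l => ln (N (fold_left (fun M e => mat2_mul (Ymat e) M) l A)))
      (bitseqs n)) / 2 ^ n -
    transfer_iter n ln_sum (2 * m11 A + m12 A) (2 * m21 A + m22 A)) <= K).
{ specialize (H mat2_id). simpl in H.
  replace (2 * 1 + 0) with 2 in H by ring. replace (2 * 0 + 1) with 1 in H by ring.
  apply H; lra. }
induction n as [| n IH]; intros A H1 H2 H3 H4 Hs.
- unfold transfer_iter, ln_sum; simpl.
  replace ((_ + 0) / 1) with (ln (N A)) by field. now apply HK.
- rewrite transfer_iter_S. simpl bitseqs.
  rewrite map_app, sumR_app, !map_map. simpl fold_left.
  pose proof (IH (mat2_mul (Ymat true) A)) as I1.
  pose proof (IH (mat2_mul (Ymat false) A)) as I0.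
  cbn [mat2_mul Ymat m11 m12 m21 m22] in I1, I0.
  specialize (I1 ltac:(lra) ltac:(lra) ltac:(lra) ltac:(lra) ltac:(lra)).
  specialize (I0 ltac:(lra) ltac:(lra) ltac:(lra) ltac:(lra) ltac:(lra)).
  set (s1 := sumR _) in I1. set (s0 := sumR _) in I0.
  match goal with |- Rabs ((?a + ?b) / _ - _) <= _ =>
    change a with s0; change b with s1 end.
  replace (2 * (1 * m11 A + 1 * m21 A) + (1 * m12 A + 1 * m22 A)) with
    (2 * m11 A + m12 A + (2 * m21 A + m22 A)) in I1 by ring.
  replace (2 * (1 * m11 A + 0 * m21 A) + (1 * m12 A + 0 * m22 A)) with
    (2 * m11 A + m12 A) in I1 by ring.
  replace (2 * (0 * m11 A + 1 * m21 A) + (0 * m12 A + 1 * m22 A)) with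
    (2 * m21 A + m22 A) in I0 by ring.
  replace (2 * (1 * m11 A + 0 * m21 A) + (1 * m12 A + 0 * m22 A)) with
    (2 * m11 A + m12 A) in I0 by ring.
  apply Rabs_le_between in I1. apply Rabs_le_between in I0.
  replace ((s0 + s1) / 2 ^ S n) with ((s0 / 2 ^ n + s1 / 2 ^ n) / 2)
    by (simpl; field; apply pow_nonzero; lra).
  apply Rabs_le. lra.
Qed.

(** The error is [(u n - n l - b l) / (n + b)], whose numerator is bounded by [K + b * Rabs l]. The
    shift [b] will be 0, 4 and 7. *)
Lemma is_lim_seq_div_INR_shift (u : nat -> R) (K b l : R) : 0 <= b ->
  (forall n, Rabs (u n - INR n * l) <= K) ->
  is_lim_seq (fun n => u n / (INR n + b)) l.
Proof.
intros Hb Hu.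
assert (HK : 0 <= K) by (eapply Rle_trans; [apply Rabs_pos | apply (Hu 0%nat)]).
set (C := K + b * Rabs l).
apply is_lim_seq_le_le_loc with (fun n => l - C / INR n) (fun n => l + C / INR n).
- exists 1%nat. intros n Hn. assert (Hn0 : 0 < INR n) by (apply lt_0_INR; lia).
  apply Rabs_le_between'.
  replace (u n / (INR n + b) - l) with ((u n - INR n * l - b * l) / (INR n + b))
    by (field; lra).
  unfold Rdiv at 1. rewrite Rabs_mult, (Rabs_pos_eq (/ _)).
  2: { left. apply Rinv_0_lt_compat; lra. }
  apply Rmult_le_compat; [apply Rabs_pos | left; apply Rinv_0_lt_compat; lra | |
    apply Rinv_le_contravar; lra].
  eapply Rle_trans; [apply Rabs_triang |].
  rewrite Rabs_Ropp, Rabs_mult, (Rabs_pos_eq b) by auto. unfold C.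
  specialize (Hu n). lra.
- replace (Finite l) with (Finite (l - 0)) by (f_equal; ring).
  apply is_lim_seq_minus'; [apply is_lim_seq_const | apply is_lim_seq_const_div_INR].
- replace (Finite l) with (Finite (l + 0)) by (f_equal; ring).
  apply is_lim_seq_plus'; [apply is_lim_seq_const | apply is_lim_seq_const_div_INR].
Qed.

Theorem theorem3p6 (N : mat2 -> R) (HN : is_mat_norm N) :
  exists lambda : R,
    Un_cv (fun n => ElogS N n / INR n) lambda /\
    (forall n : nat, p_seq n <= lambda <= q_seq n) /\
    Un_cv p_seq lambda /\
    Un_cv q_seq lambda.
Proof.
destruct log_snd_mean_lim as (l & Hl & Hlim).
pose proof (fun n => log_sum_mean_bounds l n Hlim Hl) as Hbnd.
assert (Hseq : forall n c, 0 < c ->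
    ln (INR (c_seq n)) / ((INR n + c) * 2 ^ n) = log_sum_mean n / (INR n + c)).
{ intros n c Hc. rewrite ln_c_seq. pose proof (pos_INR n). field.
  split; [lra | apply pow_nonzero; lra]. }
(* The difference lies between [4 * l] and [7 * l], and [l] is nonnegative. *)
assert (Hclose : forall n, Rabs (log_sum_mean n - INR n * l) <= 7 * l).
{ intros n. specialize (Hbnd n). apply Rabs_le. lra. }
exists l. repeat split.
- apply is_lim_seq_Reals. destruct (ElogS_close N HN) as [K HK].
  apply is_lim_seq_ext with (fun n => ElogS N n / (INR n + 0)).
  { intros n. now rewrite Rplus_0_r. }
  apply is_lim_seq_div_INR_shift with (K + 7 * l); [lra |]. intros n.
  replace (ElogS N n - INR n * l) with
    ((ElogS N n - log_sum_mean n) + (log_sum_mean n - INR n * l)) by ring.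
  eapply Rle_trans; [apply Rabs_triang |]. specialize (HK n). specialize (Hclose n). lra.
- unfold p_seq. rewrite Hseq by lra. pose proof (pos_INR n).
  apply Rmult_le_reg_r with (INR n + 7); [lra |].
  unfold Rdiv. rewrite Rmult_assoc, Rinv_l by lra. specialize (Hbnd n). lra.
- unfold q_seq. rewrite Hseq by lra. pose proof (pos_INR n).
  apply Rmult_le_reg_r with (INR n + 4); [lra |].
  unfold Rdiv. rewrite Rmult_assoc, Rinv_l by lra. specialize (Hbnd n). lra.
- apply is_lim_seq_Reals.
  apply is_lim_seq_ext with (fun n => log_sum_mean n / (INR n + 7)).
  { intros n. unfold p_seq. rewrite Hseq; lra. }
  apply is_lim_seq_div_INR_shift with (7 * l); [lra | auto].
- apply is_lim_seq_Reals.
  apply is_lim_seq_ext with (fun n => log_sum_mean n / (INR n + 4)).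
  { intros n. unfold q_seq. rewrite Hseq; lra. }
  apply is_lim_seq_div_INR_shift with (7 * l); [lra | auto].
Qed.
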